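(* Let $\Gamma=(X,R)$ be a bipartite distance-regular graph with diameter $D\ge 4$, valency $k\ge 3$ and eigenvalues $\theta_0>\theta_1>\cdots>\theta_D$. Put $d=\lfloor D/2\rfloor$, fix $x\in X$ and let $T=T(x)$. Choose $n\in\{1,d\}$ if $D$ is odd, and let $n=1$ if $D$ is even. Let $W$ be a thin irreducible $T$-module with endpoint $2$ and local eigenvalue $\tilde\theta_n=-1-\dfrac{b_2b_3}{\theta_n^2-b_2}$. Let $v$ be a nonzero vector in $E_2^*W$. Then the vectors $E_{i+2}^*A_iv$ $(0\le i\le D-4)$ are mutually orthogonal and $$\|E_{i+2}^*A_iv\|^2=\frac{k_ib_ib_{i+1}c_{i+1}c_{i+2}}{k\,b_1(\theta_n^2-b_2)}\,\frac{p_{i+2}(\theta_n)}{p_i(\theta_n)}\,\|v\|^2\qquad(0\le i\le D-4),$$ where the polynomials $p_i$ are as defined in the context (the denominators are nonzero).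
   Context: Graphs are finite, undirected, connected, without loops or multiple edges; $\partial$ denotes path-length distance. A graph $\Gamma=(X,R)$ of diameter $D$ is distance-regular if for all $0\le h,i,j\le D$ and all $x,y\in X$ with $\partial(x,y)=h$ the number $p^h_{ij}=|\{z\in X:\partial(x,z)=i,\ \partial(z,y)=j\}|$ depends only on $h,i,j$. Write $c_i=p^i_{1,i-1}$ $(1\le i\le D)$, $b_i=p^i_{1,i+1}$ $(0\le i\le D-1)$, $k=b_0$ (the valency), $k_i=p^0_{ii}$. $\Gamma$ is bipartite if $X$ can be partitioned into two subsets neither of which contains an edge. For $0\le i\le D$, $A_i\in\mathrm{Mat}_X(\mathbb C)$ is the $i$th distance matrix: its $(y,z)$ entry is $1$ if $\partial(y,z)=i$ and $0$ otherwise; $A=A_1$ is the adjacency matrix. The distinct eigenvalues of $A$ are $\theta_0>\cdots>\theta_D$ (real). For bipartite $\Gamma$ with $D\ge4$, $\theta_1^2>b_2>\theta_d^2$. $V=\mathbb C^X$ carries the Hermitian inner product $\langle u,v\rangle=u^t\overline v$, $\|u\|^2=\langle u,u\rangle$. Polynomials: $f_0,\ldots,f_D\in\mathbb R[\lambda]$ are defined by $f_{-1}=0$, $f_0=1$ and $\lambda f_i=b_{i-1}f_{i-1}+c_{i+1}f_{i+1}$ for $0\le i\le D-1$. For $0\le i\le D$, $p_i=f_0+f_2+\cdots+f_i$ if $i$ is even and $p_i=f_1+f_3+\cdots+f_i$ if $i$ is odd. For fixed $x\in X$, $E_i^*=E_i^*(x)$ is the diagonal matrix in $\mathrm{Mat}_X(\mathbb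 C)$ with $(y,y)$ entry $1$ if $\partial(x,y)=i$ and $0$ otherwise. $T=T(x)$ is the subalgebra of $\mathrm{Mat}_X(\mathbb C)$ generated by $A,E_0^*,\ldots,E_D^*$. A $T$-module is a subspace $W\subseteq V$ with $BW\subseteq W$ for all $B\in T$; it is irreducible if it is nonzero and contains no $T$-modules other than $0$ and $W$. The endpoint of an irreducible $W$ is $\min\{i:E_i^*W\ne0\}$; $W$ is thin if $\dim E_i^*W\le1$ for $0\le i\le D$. If $W$ is thin irreducible with endpoint $2$, then $E_2^*W$ is a one-dimensional eigenspace for $E_2^*A_2E_2^*$; the corresponding eigenvalue is called the local eigenvalue of $W$. *)

(* Defs.v *)
From HB Require Import structures.
From mathcomp Require Import all_boot all_order all_algebra.
From mathcomp Require Import complex reals.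

Set Implicit Arguments.
Unset Strict Implicit.
Unset Printing Implicit Defensive.

Import Order.TTheory GRing.Theory Num.Theory.

Local Open Scope ring_scope.
Local Open Scope complex_scope.

Record graph (X : finType) := Graph {
  adj : rel X;
  adj_sym : symmetric adj;
  adj_irr : irreflexive adj;
  adj_connected : forall x y, connect adj x y }.

Section Distance.
Variables (X : finType) (G : graph X).
Implicit Types (x y z : X) (h i j n : nat).

Definition has_walk n x y : bool :=
  [exists p : n.-tuple X, path (adj G) x p && (last x p == y)].

Lemma has_walk_ex x y : exists n, has_walk n x y.
Proof.
have /connectP[p pp ->] := adj_connected G x y.
by exists (size p); apply/existsP; exists (in_tuple p); rewrite pp eqxx.
Qed.

Definition dist x y : nat := ex_minn (has_walk_ex x y).

Definition diam : nat := \max_(x : X) \max_(y : X) dist x y.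

Definition sphere_meet i j x y : {set X} :=
  [set z | (dist x z == i) && (dist z y == j)].

Definition distance_regular : Prop :=
  forall h i j, (h <= diam)%N -> (i <= diam)%N -> (j <= diam)%N ->
  forall x y x' y', dist x y = h -> dist x' y' = h ->
    #|sphere_meet i j x y| = #|sphere_meet i j x' y'|.

(* The count is read off an arbitrary pair at distance [h]; for a
   distance-regular graph the choice is immaterial ([inter_numE]). *)
Definition inter_num h i j : nat :=
  if [pick u : X * X | dist u.1 u.2 == h] is Some u
  then #|sphere_meet i j u.1 u.2| else 0%N.

Lemma inter_numE h i j x y : distance_regular ->
  (i <= diam)%N -> (j <= diam)%N -> dist x y = h ->
  inter_num h i j = #|sphere_meet i j x y|.
Proof.
move=> dr ile jle dxy; rewrite /inter_num; case: pickP => [u /eqP du|/(_ (x, y))].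
  apply: (dr h) => //; rewrite -dxy.
  apply: leq_trans (leq_bigmax x).
  exact: (leq_bigmax (F := fun y => dist x y)).
by rewrite /= dxy eqxx.
Qed.

Definition c_ i : nat := inter_num i 1 i.-1.
Definition b_ i : nat := inter_num i 1 i.+1.
Definition k_ i : nat := inter_num 0 i i.
Definition valency : nat := b_ 0.

Definition bipartite : Prop :=
  exists Y Z : {set X},
    [/\ Y :|: Z = setT, Y :&: Z = set0,
        {in Y &, forall y z, ~~ adj G y z} &
        {in Z &, forall y z, ~~ adj G y z}].

End Distance.

Section Polynomials.
Variables (R : realType) (X : finType) (G : graph X).

(* The recurrence  'X f_i = b_{i-1} f_{i-1} + c_{i+1} f_{i+1},  f_{-1} = 0,
   solved for f_{i+1}; it is meaningful for i < diam G, where c_{i+1} != 0. *)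
Fixpoint f_ (i : nat) : {poly R} :=
  match i with
  | 0 => 1
  | 1 => (c_ G 1)%:R^-1 *: 'X
  | (j.+1 as j1).+1 =>
      (c_ G j.+2)%:R^-1 *: ('X * f_ j1 - (b_ G j)%:R *: f_ j)
  end.

Lemma f_1 : c_ G 1 != 0%N -> 'X * f_ 0 = (c_ G 1)%:R *: f_ 1.
Proof. by move=> c0; rewrite /= mulr1 scalerA divff ?scale1r ?pnatr_eq0. Qed.

Lemma f_rec i : c_ G i.+2 != 0%N ->
  'X * f_ i.+1 = (b_ G i)%:R *: f_ i + (c_ G i.+2)%:R *: f_ i.+2.
Proof.
move=> c0; rewrite [f_ i.+2]/= scalerA divff ?pnatr_eq0 //.
by rewrite scale1r addrC subrK.
Qed.

Definition p_ (i : nat) : {poly R} :=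
  \sum_(j < i.+1 | odd j == odd i) f_ j.

End Polynomials.

(* Matrices and vectors indexed by X are encoded over 'I_#|X| through
   [enum_val : 'I_#|X| -> X]. *)
Section Terwilliger.
Variables (R : realType) (X : finType) (G : graph X).
Local Notation C := R[i].
Local Notation "'MatX'" := 'M[C]_#|X|.
Local Notation V := 'cV[C]_#|X|.
Implicit Types (x : X) (W U : {vspace V}) (u v : V).

Definition distance_mx (i : nat) : MatX :=
  \matrix_(y, z) (dist G (enum_val y) (enum_val z) == i)%:R.

Definition adjacency_mx : MatX := distance_mx 1.

Definition Estar x (i : nat) : MatX :=
  diag_mx (\row_y (dist G x (enum_val y) == i)%:R).

Definition ordered_eigenvalues (theta : nat -> R) : Prop :=
  (forall i j, (i < j <= diam G)%N -> theta j < theta i) /\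
  (forall z : C, eigenvalue adjacency_mx z <->
     exists2 i, (i <= diam G)%N & z = (theta i)%:C).

Inductive in_T x : MatX -> Prop :=
  | T_adj : in_T x adjacency_mx
  | T_Estar i : (i <= diam G)%N -> in_T x (Estar x i)
  | T_one : in_T x 1%:M
  | T_scale a B : in_T x B -> in_T x (a *: B)
  | T_add B B' : in_T x B -> in_T x B' -> in_T x (B + B')
  | T_mul B B' : in_T x B -> in_T x B' -> in_T x (B *m B').

Definition T_module x W : Prop :=
  forall B, in_T x B -> forall w, w \in W -> B *m w \in W.

Definition irreducible_T_module x W : Prop :=
  [/\ T_module x W, W != 0%VS &
      forall U, T_module x U -> (U <= W)%VS -> U = 0%VS \/ U = W].

Definition EstarV x (i : nat) W : {vspace V} :=
  (linfun (mulmx (Estar x i)) @: W)%VS.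

Definition has_endpoint x W (r : nat) : Prop :=
  EstarV x r W != 0%VS /\
  forall i, (i <= diam G)%N -> EstarV x i W != 0%VS -> (r <= i)%N.

Definition thin x W : Prop :=
  forall i, (i <= diam G)%N -> (\dim (EstarV x i W) <= 1)%N.

(* Meant for W thin irreducible of endpoint 2: then E_2^* W is a line, and
   this determines eta. *)
Definition has_local_eigenvalue x W (eta : C) : Prop :=
  forall v, v \in EstarV x 2 W ->
    (Estar x 2 *m distance_mx 2 *m Estar x 2) *m v = eta *: v.

Definition inner u v : C := (u^T *m map_mx Num.conj v) 0 0.

Definition normsq u : C := inner u u.

End Terwilliger.

(* Main.v *)
Require Import Defs.
From HB Require Import structures.
From mathcomp Require Import all_boot all_order all_algebra.
From mathcomp Require Import complex reals polyrcf.
From mathcomp Require Import ring lra zify.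

(** Write [w_i = E_(i+2) A_i v] and [u_i = E_(i+2) A_(i+4) v], with [E_i] the
    projection onto the sphere of radius [i] about [x].  The [w_i] are
    orthogonal because they live on different spheres; what has to be computed
    is their norms.

    Since [E_0 W = E_1 W = 0], the entries of [v] sum to [0], and only the
    distances [i], [i+2], [i+4] occur between the spheres of radius [i+2] and
    [2]; hence [E_(i+2) A_(i+2) v = - (w_i + u_i)].  Applying [E_j] to the
    relation [A A_i = b_(i-1) A_(i-1) + c_(i+1) A_(i+1)] then says how [A] moves
    these vectors from one sphere to the next: [w_i] is raised to
    [c_(i+1) w_(i+1)], [u_(i+1)] is lowered to [b_(i+4) u_i], and the lowering of
    [w_(i+1)] is a combination of [w_i], [u_i] and a raising of [w_(i-1)] and
    [u_(i-1)].  Thinness makes [u_i = r_i w_i], and comparing the two lowerings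
    gives a recurrence for [r_i], started by the local eigenvalue, which says
    [r_0 = b_2 b_3 / (theta_n^2 - b_2)].  The recurrence is solved by
      [r_i = b_(i+2) b_(i+3) p_i / (c_(i+1) c_(i+2) p_(i+2))] at [theta_n],
    because the [p_i] satisfy [X p_i = c_(i+1) p_(i+1) + b_(i+1) p_(i-1)]
    ([p_rec], [lowering_ratio], [far_eq_ratio_near]).  As [A] is self-adjoint,
    raising [w_i] and lowering [w_(i+1)] are adjoint to each other, and this gives
    the quotient of consecutive norms ([normsq_near_rec]).

    All of this divides by values [p_i(theta_n)] with [i <= D - 2], so these must
    be nonzero ([p_theta_neq0]).  From [(X^2 - k^2) p_(D-1) = k (X f_D - b_(D-1) f_(D-1))],
    whose right side vanishes at every eigenvalue, the zeros of [p_(D-1)] are exactly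
    [theta_1, ..., theta_(D-1)].  By the recurrence, [theta_1], the largest zero
    of [p_(D-1)], lies beyond all zeros of the earlier [p_i], and for odd [D] the
    smallest positive zero [theta_d] lies below all positive zeros of the earlier
    [p_i].  This is Sturm's argument: at the first point where one of the [p_i]
    vanishes while none has changed sign, the recurrence lets only the last one
    vanish. *)

Set Implicit Arguments.
Unset Strict Implicit.
Unset Printing Implicit Defensive.

Import Order.TTheory GRing.Theory Num.Theory.

(** * Distances and intersection numbers *)

Section Metric.
Variables (X : finType) (G : graph X).
Implicit Types (x y z : X) (h i j n : nat).

Lemma has_walkP n x y :
  reflect (exists p, [/\ size p = n, path (adj G) x p & last x p = y])
          (has_walk G n x y).
Proof.
apply: (iffP existsP) => [[p /andP[px /eqP py]]|[p [sp px py]]].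
  by exists p; rewrite size_tuple.
have sp' : size p == n by apply/eqP.
by exists (Tuple sp'); rewrite /= px py eqxx.
Qed.

Lemma distP x y : has_walk G (dist G x y) x y.
Proof. by rewrite /dist; case: ex_minnP. Qed.

Lemma dist_le n x y : has_walk G n x y -> dist G x y <= n.
Proof. by rewrite /dist; case: ex_minnP => m _; apply. Qed.

Lemma distxx x : dist G x x = 0.
Proof. by apply/eqP; rewrite -leqn0; apply/dist_le/has_walkP; exists [::]. Qed.

Lemma dist_eq0 x y : (dist G x y == 0) = (x == y).
Proof.
apply/eqP/eqP => [d0|->]; last exact: distxx.
by have /has_walkP[p] := distP x y; rewrite d0 => -[/size0nil -> _ /=].
Qed.

Lemma dist_triangle y x z : dist G x z <= dist G x y + dist G y z.
Proof.
have /has_walkP[p [sp px py]] := distP x y.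
have /has_walkP[q [sq qy qz]] := distP y z.
apply/dist_le/has_walkP; exists (p ++ q).
by rewrite size_cat sp sq cat_path px last_cat py qy qz.
Qed.

Lemma distC x y : dist G x y = dist G y x.
Proof.
suff le a b : dist G a b <= dist G b a by apply/eqP; rewrite eqn_leq !le.
have /has_walkP[p [sp pb pa]] := distP b a.
apply/dist_le/has_walkP; exists (rev (belast b p)); split.
- by rewrite size_rev size_belast.
- by rewrite -pa rev_path (eq_path (e' := adj G)) // => u w; exact: adj_sym.
- by case: p {sp pb} pa => [|c p] //= _; rewrite rev_cons last_rcons.
Qed.

Lemma dist_eq1 x y : (dist G x y == 1) = adj G x y.
Proof.
apply/eqP/idP => [d1|axy].
  have /has_walkP[p] := distP x y; rewrite d1.
  by case: p => [|a [|b p]] [] //= _ /andP[? _] <-.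
have le1 : dist G x y <= 1.
  by apply/dist_le/has_walkP; exists [:: y]; rewrite /= axy.
have : dist G x y != 0.
  by rewrite dist_eq0; apply/eqP => xy; move: axy; rewrite xy adj_irr.
by case: (dist G x y) le1 => [|[|]].
Qed.

Lemma dist_diam x y : dist G x y <= diam G.
Proof.
apply: leq_trans (leq_bigmax x).
exact: (leq_bigmax (F := fun y => dist G x y)).
Qed.

Lemma diam_attained x0 : exists x y, dist G x y = diam G.
Proof.
have X0 : 0 < #|X| by apply/card_gt0P; exists x0.
rewrite /diam; have [x ->] := @bigop.eq_bigmax X (fun x => \max_y dist G x y) X0.
by have [y ->] := @bigop.eq_bigmax X (fun y => dist G x y) X0; exists x, y.
Qed.

(** The second vertex of a shortest path is one step closer to its end. *)
Lemma dist_step x y h : dist G x y = h.+1 ->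
  exists2 z, dist G x z = 1 & dist G z y = h.
Proof.
move=> dxy; have /has_walkP[p] := distP x y; rewrite dxy.
case: p => [|z p] [] //= [sp] /andP[xz zp] py.
have dxz : dist G x z = 1 by apply/eqP; rewrite dist_eq1.
exists z => //; apply/eqP; rewrite eqn_leq.
rewrite dist_le ?(introT (has_walkP _ _ _)) //; last by exists p.
by have := dist_triangle z x y; rewrite dxy dxz add1n ltnS.
Qed.

Lemma dist_reach x0 h : h <= diam G -> exists x y, dist G x y = h.
Proof.
move=> hD; have [x [y dxy]] := diam_attained x0.
rewrite -(subKn hD); elim: (diam G - h) => [|m [a [b IH]]].
  by exists x, y; rewrite subn0.
have [le|lt] := leqP (diam G) m.
  by exists a, b; rewrite IH; move: le (leqW le); rewrite -!subn_eq0 => /eqP-> /eqP->.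
have /dist_step[z _ dz] : dist G a b = (diam G - m.+1).+1.
  by rewrite IH -subSn.
by exists z, b.
Qed.

Section Bipartite.
Hypothesis hbip : bipartite G.

Lemma bipartite_coloring :
  exists col : X -> bool, forall x y, adj G x y -> col y = ~~ col x.
Proof.
have [Y [Z [YZ YZ0 hY hZ]]] := hbip; exists (mem Y) => x y axy.
have inZ u : u \notin Y -> u \in Z.
  by move=> uY; have : u \in Y :|: Z by [rewrite YZ inE]; rewrite inE (negPf uY).
rewrite /=; have [xY|xY] := boolP (x \in Y); have [yY|yY] := boolP (y \in Y) => //.
  by move: (hY _ _ xY yY); rewrite axy.
by move: (hZ _ _ (inZ _ xY) (inZ _ yY)); rewrite axy.
Qed.

(** Every closed walk of a bipartite graph is even. *)
Lemma odd_dist x y z : odd (dist G x z) = odd (dist G x y) (+) odd (dist G y z).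
Proof.
have [col colP] := bipartite_coloring.
have col_walk n a b : has_walk G n a b -> col b = col a (+) odd n.
  move=> /has_walkP[p []]; elim: p n a => [|c p IH] n a /= <-.
    by move=> _ <-; rewrite addbF.
  case/andP=> ac cp cb; rewrite (IH _ _ erefl cp cb) (colP _ _ ac) /=.
  by case: (col a); case: (odd _).
have := col_walk _ _ _ (distP x z); rewrite (col_walk _ _ _ (distP y z)).
rewrite (col_walk _ _ _ (distP x y)).
by case: (col x); do 3 case: (odd _).
Qed.

Lemma dist_adj x y z : dist G y z = 1 ->
  dist G x z = (dist G x y).+1 \/ (dist G x z).+1 = dist G x y.
Proof.
move=> d1; have o := odd_dist x y z.
have := dist_triangle y x z; have := dist_triangle z x y.
rewrite (distC z y) d1 !addn1; rewrite d1 /= addbT in o.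
move=> le1 le2; case: (ltngtP (dist G x y) (dist G x z)) => [lt|lt|e].
- by left; lia.
- by right; lia.
- by move: o; rewrite e; case: (odd _).
Qed.

End Bipartite.

Section DistanceRegular.
Hypothesis hdr : distance_regular G.
Hypothesis hD : 1 <= diam G.

(** At distance [diam G] no vertex lies further away, and both sides are [0]. *)
Lemma b_E x y : #|sphere_meet G 1 (dist G x y).+1 x y| = b_ G (dist G x y).
Proof.
rewrite /b_; have [le|lt] := leqP (dist G x y).+1 (diam G).
  by rewrite (inter_numE hdr hD le (x := x) (y := y)).
have empty u w : #|sphere_meet G 1 (dist G x y).+1 u w| = 0.
  apply/eqP; rewrite cards_eq0 -subset0; apply/subsetP => z.
  rewrite !inE => /andP[_ /eqP dz].
  by move: (dist_diam z w); rewrite dz leqNgt lt.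
by rewrite /inter_num empty; case: pickP.
Qed.

Lemma c_E x y : #|sphere_meet G 1 (dist G x y).-1 x y| = c_ G (dist G x y).
Proof.
rewrite /c_ (inter_numE hdr hD _ (x := x) (y := y)) //.
exact: leq_trans (leq_pred _) (dist_diam _ _).
Qed.

Lemma k_E x i : i <= diam G -> k_ G i = #|[set y | dist G x y == i]|.
Proof.
move=> iD; rewrite /k_ (inter_numE hdr iD iD (distxx x)); apply: eq_card => y.
by rewrite !inE (distC y x) andbb.
Qed.

Lemma c_gt0 x0 i : 0 < i <= diam G -> 0 < c_ G i.
Proof.
case/andP=> i0 /(dist_reach x0)[x [y dxy]].
rewrite -dxy -c_E; apply/card_gt0P.
have [z dz dzy] : exists2 z, dist G x z = 1 & dist G z y = i.-1.
  by apply: dist_step; rewrite dxy prednK.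
by exists z; rewrite inE dz dzy dxy !eqxx.
Qed.

Lemma b_gt0 x0 i : i < diam G -> 0 < b_ G i.
Proof.
case/(dist_reach x0)=> x [y dxy]; have [z dz dzy] := dist_step dxy.
rewrite -dzy -b_E; apply/card_gt0P; exists x.
by rewrite inE distC dz dxy dzy !eqxx.
Qed.

Lemma b_diam x0 : b_ G (diam G) = 0.
Proof.
have [x [y dxy]] := diam_attained x0.
rewrite -dxy -b_E; apply/eqP; rewrite cards_eq0 -subset0; apply/subsetP => z.
by rewrite !inE dxy => /andP[_ /eqP e]; have := dist_diam z y; rewrite e ltnn.
Qed.

Lemma c_0 x : c_ G 0 = 0.
Proof.
rewrite -{1}(distxx x) -c_E; apply/eqP; rewrite cards_eq0 -subset0.
apply/subsetP => z; rewrite !inE distxx /= (dist_eq0 z x) => /andP[/eqP d /eqP zx].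
by move: d; rewrite zx distxx.
Qed.

Lemma c_1 x0 : c_ G 1 = 1.
Proof.
have [x [y dxy]] := dist_reach x0 hD.
rewrite -{1}dxy -c_E dxy /= -(cards1 y); apply: eq_card => z.
by rewrite !inE cards1 (dist_eq0 z y) andbC; case: (z =P y) => [->|//]; rewrite dxy.
Qed.

Lemma k_0 x : k_ G 0 = 1.
Proof.
by rewrite (k_E x) // -(cards1 x); apply: eq_card => z; rewrite !inE dist_eq0 eq_sym.
Qed.

(** In a bipartite graph no neighbour of [x] lies at the same distance from
    [y] as [x] does. *)
Lemma b_add_c x0 i : bipartite G -> i <= diam G -> b_ G i + c_ G i = valency G.
Proof.
move=> hbip /(dist_reach x0)[x [y dxy]].
rewrite /valency -(distxx x) -b_E distxx -dxy -b_E -c_E dxy.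
have -> : sphere_meet G 1 1 x x =
    sphere_meet G 1 i.+1 x y :|: sphere_meet G 1 i.-1 x y.
  apply/setP => z; rewrite !inE (distC z x) andbb -andb_orr.
  case: (dist G x z =P 1) => //= dxz; apply/esym/orP.
  have := dist_adj hbip y dxz; rewrite !(distC y) dxy.
  by case=> [->|<-]; [left|right].
rewrite cardsU (_ : _ :&: _ = set0) ?cards0 ?subn0 //.
apply/setP => z; rewrite !inE; apply/negbTE; apply/negP.
case/andP=> /andP[_ /eqP e] /andP[_]; rewrite e => /eqP /esym.
by case: (i) => [|m] //= /eqP; rewrite -[_ == _]/(m == m.+2) ltn_eqF.
Qed.

(** Edges between consecutive spheres, counted from both sides. *)
Lemma k_rec x i : i < diam G -> k_ G i * b_ G i = k_ G i.+1 * c_ G i.+1.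
Proof.
move=> iD; rewrite (k_E x (ltnW iD)) (k_E x iD).
pose e y z := (dist G y z == 1) : nat.
have cardE (A : {set X}) : #|A| = \sum_(y : X) (y \in A).
  by rewrite -sum1_card big_mkcond; apply: eq_bigr => y _; case: (y \in A).
transitivity (\sum_(y in [set y | dist G x y == i])
               \sum_(z in [set z | dist G x z == i.+1]) e y z).
  rewrite -sum_nat_const; apply: eq_bigr => y; rewrite inE => /eqP dxy.
  rewrite -dxy -(distC y x) -b_E cardE [RHS]big_mkcond; apply: eq_bigr => z _.
  rewrite !inE /e (distC y x) dxy (distC x z).
  by rewrite andbC; case: (_ == i.+1).
rewrite exchange_big /= -sum_nat_const.
apply: eq_bigr => z; rewrite inE => /eqP dxz.
rewrite -dxz -(distC z x) -c_E cardE (distC z x) dxz /= big_mkcond.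
apply: eq_bigr => y _; rewrite !inE /e (distC y x) (distC z y).
by rewrite andbC; case: (_ == i).
Qed.

End DistanceRegular.
End Metric.

(** * Zeros of polynomials satisfying a three-term recurrence *)

Local Open Scope ring_scope.

Section ZeroSelection.
Variable R : rcfType.
Implicit Types (a b x y : R) (q : {poly R}) (s : seq R).

Lemma seq_max s x : x \in s -> exists2 y, y \in s & {in s, forall z, z <= y}.
Proof.
move=> xs; have [s0|[y ys ymax]] : s = [::] \/
    exists2 y, y \in s & {in s, forall z, z <= y}; last by exists y.
  elim: s {xs} => [|c s [->|[y ys ymax]]]; [by left| |]; right.
    by exists c; rewrite ?inE ?eqxx // => z; rewrite inE => /eqP->.
  have [le|lt] := leP c y.
    by exists y => [|z]; rewrite inE ?ys ?orbT // => /predU1P[->|/ymax].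
  exists c; first by rewrite inE eqxx.
  by move=> z; rewrite inE => /predU1P[->//|/ymax zy]; exact: le_trans (ltW lt).
by move: xs; rewrite s0.
Qed.

(** Moving left from [b], where finitely many polynomials are positive, until
    one of them first vanishes: none of them has become negative, since a sign
    change would need an earlier zero. *)
Lemma first_zero_from_right (ps : seq {poly R}) a b q :
    {in ps, forall p, 0 < p.[b]} -> q \in ps -> a <= b -> root q a ->
  exists t, [/\ a <= t <= b, {in ps, forall p, 0 <= p.[t]} &
                exists2 p, p \in ps & root p t].
Proof.
move=> pos_b qps ab qa.
pose s := [seq y <- flatten [seq rootsR p | p <- ps] | y <= b].
have sP y : reflect ((y <= b) /\ exists2 p, p \in ps & root p y) (y \in s).
  have rootE p z : p \in ps -> (z \in rootsR p) = root p z.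
    move=> pps; rewrite -roots_on_rootsR ?in_itv //.
    by apply: contraTneq (pos_b _ pps) => ->; rewrite horner0 ltxx.
  rewrite mem_filter; apply: (iffP andP) => [[yb /flatten_mapP[p pps]]|[yb [p pps py]]].
    by rewrite rootE // => py; split => //; exists p.
  by split => //; apply/flatten_mapP; exists p; rewrite ?rootE.
have as_ : a \in s by apply/sP; split => //; exists q.
have [t /sP[tb t_root] tmax] := seq_max as_.
exists t; split => //; first by rewrite tmax.
move=> p pps; rewrite leNgt; apply/negP => pt.
have [y /andP[ty yb] py] : exists2 y, t <= y <= b & root p y.
  by apply: poly_ivt => //; rewrite (ltW pt) (ltW (pos_b _ pps)).
have ys : y \in s by apply/sP; split => //; exists p.
have yt : y = t by apply/eqP; rewrite eq_le ty tmax.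
by move: pt; rewrite -yt (rootP py) ltxx.
Qed.

End ZeroSelection.

Section ThreeTermRecurrence.
Variables (R : rcfType) (m : nat) (b c : nat -> R) (k : R) (p : nat -> {poly R}).
Let D := m.+1.
Hypothesis c_pos : forall i, (0 < i <= D)%N -> 0 < c i.
Hypothesis b_pos : forall i, (i < D)%N -> 0 < b i.
Hypothesis b_last : b D = 0.
Hypothesis bc_sum : forall i, (i <= D)%N -> b i + c i = k.
Hypothesis p0 : p 0%N = 1.
Hypothesis p1 : 'X * p 0%N = c 1%N *: p 1%N.
Hypothesis pS : forall i, (i.+2 <= D)%N ->
  'X * p i.+1 = c i.+2 *: p i.+2 + b i.+2 *: p i.
Implicit Types (i j : nat) (l : R).

Let p0E l : (p 0%N).[l] = 1. Proof. by rewrite p0 hornerC. Qed.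

Let p1E l : c 1%N * (p 1%N).[l] = l.
Proof.
by have /(congr1 (horner^~ l)) := p1; rewrite p0 mulr1 hornerX hornerZ => <-.
Qed.

Lemma p_recE i l : (i.+2 <= D)%N ->
  l * (p i.+1).[l] = c i.+2 * (p i.+2).[l] + b i.+2 * (p i).[l].
Proof.
by move/pS/(congr1 (horner^~ l)); rewrite hornerM hornerX hornerD !hornerZ => <-.
Qed.

Let b_ge0 i : (i <= D)%N -> 0 <= b i.
Proof. by rewrite leq_eqVlt => /predU1P[->|/b_pos/ltW//]; rewrite b_last. Qed.

Let pair_ind (P : nat -> Prop) :
  P 0%N -> P 1%N -> (forall i, P i -> P i.+1 -> P i.+2) -> forall i, P i.
Proof.
move=> P0 P1 PS i; suff [] : P i /\ P i.+1 by [].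
by elim: i => [|i [Pi Pi1]]; split => //; exact: PS.
Qed.

Lemma size_p i : (i <= D)%N -> (size (p i) <= i.+1)%N.
Proof.
elim/pair_ind: i => [||i IH IH1] iD.
- by rewrite p0 size_poly1.
- have c1 : c 1%N != 0 by rewrite gt_eqF // c_pos.
  by rewrite -(size_scale _ c1) -p1 p0 mulr1 size_polyX.
- have c2 : c i.+2 != 0 by rewrite gt_eqF // c_pos.
  rewrite -(size_scale _ c2) (_ : _ *: _ = 'X * p i.+1 - b i.+2 *: p i); last first.
    by rewrite pS // addrK.
  rewrite (leq_trans (size_polyD _ _)) // geq_max size_polyN.
  rewrite (leq_trans (size_scale_leq _ _)) ?andbT; last first.
    by rewrite (leq_trans (IH _)) //; lia.
  have [->|pn0] := eqVneq (p i.+1) 0; first by rewrite mulr0 size_poly0.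
  by rewrite mulrC size_mulX // ltnS IH1 //; lia.
Qed.

Lemma p_parity i l : (i <= D)%N -> (p i).[- l] = (-1) ^+ i * (p i).[l].
Proof.
elim/pair_ind: i => [||i IH IH1] iD; first by rewrite !p0E mulr1.
  have c1 : c 1%N != 0 by rewrite gt_eqF // c_pos.
  by apply: (mulfI c1); rewrite p1E expr1 mulN1r mulrN p1E.
have c2 : c i.+2 != 0 by rewrite gt_eqF // c_pos.
apply: (mulfI c2); have := p_recE (- l) iD; have := p_recE l iD.
rewrite IH ?IH1; try lia; rewrite !exprS => e1 e2.
apply/eqP; rewrite -subr_eq0; apply/eqP.
transitivity (- (-1) ^+ i * - (l * (p i.+1).[l] - c i.+2 * (p i.+2).[l] - b i.+2 * (p i).[l])
   - (- l * (-1 * (-1) ^+ i * (p i.+1).[l]) - c i.+2 * (p i.+2).[- l] - b i.+2 * ((-1) ^+ i * (p i).[l]))).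
  by ring.
by rewrite e1 e2; ring.
Qed.

(** Beyond [k] the [p i] increase with [i], because [c i = k - b i]. *)
Lemma p_ge1 i l : k <= l -> (i <= D)%N -> 1 <= (p i).[l].
Proof.
move=> kl iD; suff [] : 1 <= (p i).[l] /\ ((i < D)%N -> (p i).[l] <= (p i.+1).[l]) by [].
elim: i iD => [|i IH] iD; first rewrite p0E.
  split => // _; have c1 : 0 < c 1%N by rewrite c_pos.
  rewrite -(ler_pM2l c1) p1E mulr1; have := @b_ge0 1%N isT; have := @bc_sum 1%N isT; lra.
have [ge1 le] := IH (ltnW iD); have le1 := le iD; split; first exact: le_trans le1.
move=> iD'; have c2 : 0 < c i.+2 by rewrite c_pos.
rewrite -(ler_pM2l c2); have := p_recE l iD'; have := bc_sum iD'; have := b_ge0 iD'.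
nra.
Qed.

(** If [p i.+1] vanished, the recurrence would put [c * p i.+2] and [b * p i],
    both nonnegative, in a sum equal to [0], against [0 < p i]. *)
Lemma p_right_pos l : (forall i, (i <= m)%N -> 0 <= (p i).[l]) ->
  forall i, (i < m)%N -> 0 < (p i).[l].
Proof.
move=> ge0; elim=> [|i IH] im; first by rewrite p0E.
have im' : (i.+2 <= D)%N by lia.
rewrite lt_neqAle ge0 ?(ltnW im) // andbT eq_sym; apply/eqP => pi0.
have := p_recE l im'; rewrite pi0 mulr0.
have c2 : 0 < c i.+2 by rewrite c_pos.
have b2 : 0 < b i.+2 by rewrite b_pos // ltnS.
have := mulr_gt0 b2 (IH (ltnW im)); have := mulr_ge0 (ltW c2) (ge0 _ im); lra.
Qed.

(** With the signs [(-1)^j] on [p j.*2] and [p j.*2.+1] the recurrence for the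
    odd indices has only positive terms, so positivity of the odd ones is
    automatic; the recurrence for [p j.*2.+2] then forces [p j.*2] to be
    positive once [p j.*2.+2] is nonnegative. *)
Lemma p_left_neq0 d l : m = d.*2 -> 0 < l ->
    (forall j, (j <= d)%N -> 0 <= (-1) ^+ j * (p j.*2).[l]) ->
  forall i, (i < m)%N -> (p i).[l] != 0.
Proof.
move=> md l0 ge0.
have pos j : (j < d)%N ->
    0 < (-1) ^+ j * (p j.*2).[l] /\ 0 < (-1) ^+ j * (p j.*2.+1).[l].
  elim: j => [|j IH] jd.
    rewrite !mul1r p0E ltr01; split => //.
    have c1 : 0 < c 1%N by rewrite c_pos.
    by rewrite -(pmulr_rgt0 _ c1) p1E.
  have [_ O0] := IH (ltnW jd); have E1 := ge0 _ (ltnW jd); have E2 := ge0 _ jd.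
  rewrite !doubleS in E1 E2 *.
  have r3 := @p_recE j.*2.+1 l ltac:(lia); have r4 := @p_recE j.*2.+2 l ltac:(lia).
  have c3 : 0 < c j.*2.+3 by rewrite c_pos; lia.
  have c4 : 0 < c j.*2.+4 by rewrite c_pos; lia.
  have b3 : 0 < b j.*2.+3 by rewrite b_pos; lia.
  have b4 : 0 < b j.*2.+4 by rewrite b_pos; lia.
  set s := (-1) ^+ j.+1 in E1 *; have s0 : (-1) ^+ j = - s by rewrite /s exprS mulN1r opprK.
  have s2 : (-1) ^+ j.+2 = - s by rewrite /s exprS mulN1r.
  rewrite s0 in O0; rewrite s2 in E2.
  have O1 : 0 < s * (p j.*2.+3).[l].
    rewrite -(pmulr_rgt0 _ c3).
    have -> : c j.*2.+3 * (s * (p j.*2.+3).[l]) =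
        l * (s * (p j.*2.+2).[l]) + b j.*2.+3 * (- s * (p j.*2.+1).[l]).
      by rewrite mulrCA (mulrCA l) r3; ring.
    apply: ltr_wpDl; last exact: mulr_gt0.
    by apply: mulr_ge0; first exact: ltW.
  split=> //; rewrite -(pmulr_rgt0 _ b4).
  have -> : b j.*2.+4 * (s * (p j.*2.+2).[l]) =
      l * (s * (p j.*2.+3).[l]) + c j.*2.+4 * (- s * (p j.*2.+4).[l]).
    by rewrite (mulrCA l) r4; ring.
  apply: ltr_wpDr; last exact: mulr_gt0.
  by apply: mulr_ge0; first exact: ltW.
move=> i im; have jd : (i./2 < d)%N by lia.
have [/lt0r_neq0 E /lt0r_neq0 O] := pos _ jd.
rewrite -(odd_double_half i); case: (odd i) => /=; rewrite ?add1n ?add0n.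
  by move: O; rewrite mulf_eq0 negb_or => /andP[].
by move: E; rewrite mulf_eq0 negb_or => /andP[].
Qed.

Lemma p_even_at0 j : (j.*2 <= m)%N -> 0 < (-1) ^+ j * (p j.*2).[0].
Proof.
elim: j => [|j IH] jm; first by rewrite p0E mulr1.
rewrite doubleS in jm *; have r := @p_recE j.*2 0 ltac:(lia).
have c2 : 0 < c j.*2.+2 by rewrite c_pos; lia.
have b2 : 0 < b j.*2.+2 by rewrite b_pos; lia.
rewrite -(pmulr_rgt0 _ c2) (_ : _ * _ = b j.*2.+2 * ((-1) ^+ j * (p j.*2).[0])).
  by rewrite mulr_gt0 // IH; lia.
apply/eqP; rewrite -subr_eq0 exprS mulN1r; apply/eqP.
transitivity ((-1) ^+ j * (0 * (p j.*2.+1).[0]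
    - (c j.*2.+2 * (p j.*2.+2).[0] + b j.*2.+2 * (p j.*2).[0]))); first by ring.
by rewrite r subrr mulr0.
Qed.

Section Zeros.
Variable theta : nat -> R.
Hypothesis m_ge3 : (3 <= m)%N.
Hypothesis theta_dec : forall i j, (i < j <= D)%N -> theta j < theta i.
Hypothesis theta_root : forall j, (j <= D)%N ->
  root (('X^2 - (k ^+ 2)%:P) * p m) (theta j).

Let theta_le i j : (i <= j <= D)%N -> theta j <= theta i.
Proof.
by case/andP; rewrite leq_eqVlt => /predU1P[->//|ij] jD; rewrite ltW ?theta_dec ?ij.
Qed.

Let k_gt0 : 0 < k.
Proof. by rewrite -(@bc_sum 1%N) // addr_gt0 ?b_pos ?c_pos // ltnS; lia. Qed.

Let q : {poly R} := ('X^2 - (k ^+ 2)%:P) * p m.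

Let qE l : q.[l] = (l - k) * (l + k) * (p m).[l].
Proof. by rewrite !hornerE; ring. Qed.

Let q_neq0 : q != 0.
Proof.
apply/eqP => /(congr1 (horner^~ (k + 1))); rewrite qE horner0 => /eqP.
have := @p_ge1 m (k + 1) ltac:(lra) (leqnSn m).
by rewrite !mulf_eq0 => ge1 /orP[/orP[]|] /eqP; move: k_gt0; lra.
Qed.

(** The [D + 1] distinct [theta j] exhaust the degree of [q]. *)
Lemma zero_is_theta l : root q l -> exists2 j, (j <= D)%N & l = theta j.
Proof.
move=> ql; pose s := [seq theta j | j <- iota 0 D.+1].
have [/mapP[j]|ls] := boolP (l \in s).
  by rewrite mem_iota add0n ltnS => /andP[_ jD] ->; exists j.
have s_uniq : uniq (l :: s).
  rewrite cons_uniq ls map_inj_in_uniq ?iota_uniq // => i j; rewrite !mem_iota !add0n !ltnS.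
  move=> iD jD ij; case: (ltngtP i j) => // lt.
    by have := @theta_dec i j; rewrite lt jD ij ltxx => /(_ isT).
  by have := @theta_dec j i; rewrite lt iD ij ltxx => /(_ isT).
have s_root : all (root q) (l :: s).
  apply/allP => y; rewrite inE => /predU1P[->//|/mapP[j jD ->]]; apply: theta_root.
  by move: jD; rewrite mem_iota.
have := max_poly_roots q_neq0 s_root s_uniq; rewrite [size (_ :: _)]/= size_map size_iota.
have size_sq : size ('X^2 - (k ^+ 2)%:P) = 3%N by rewrite size_XnsubC.
have := size_polyMleq ('X^2 - (k ^+ 2)%:P) (p m).
rewrite size_sq -/q => le lt; have := leq_trans lt le.
by rewrite -[_.-1]/(size (p m)).+2 !ltnS ltnNge size_p.
Qed.

Lemma zero_lt_k l : root (p m) l -> - k < l < k.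
Proof.
move=> /rootP pl; apply/andP; split; rewrite ltNge; apply/negP => le.
  have := @p_ge1 m (- l) ltac:(lra) (leqnSn m).
  by rewrite p_parity // pl mulr0 ler10.
by have := @p_ge1 m l le (leqnSn m); rewrite pl ler10.
Qed.

(** [k] and [- k] are zeros of [q], and all the others are zeros of [p m], which
    lie strictly between them. *)
Lemma theta_extreme : theta 0%N = k /\ theta D = - k.
Proof.
have cases j : (j <= D)%N -> theta j = k \/ theta j = - k \/ - k < theta j < k.
  move/theta_root/rootP; rewrite -/q qE => /eqP; rewrite !mulf_eq0.
  case/orP=> [/orP[]|/zero_lt_k]; [| |by right; right].
    by rewrite subr_eq0 => /eqP; left.
  by rewrite addr_eq0 => /eqP; right; left.
have [i iD ki] : exists2 j, (j <= D)%N & k = theta j.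
  by apply: zero_is_theta; apply/rootP; rewrite qE subrr !mul0r.
have [j jD kj] : exists2 j, (j <= D)%N & - k = theta j.
  by apply: zero_is_theta; apply/rootP; rewrite qE addNr mulr0 mul0r.
split.
  have := cases 0%N isT; have := @theta_le 0%N i iD; rewrite -ki; move: k_gt0; lra.
have := cases D (leqnn D); have := @theta_le j D; rewrite jD leqnn => /(_ isT).
by rewrite -kj; move: k_gt0; lra.
Qed.

Lemma theta_inner j : (0 < j < D)%N -> root (p m) (theta j).
Proof.
case/andP=> j0 jD; have [t0 tD] := theta_extreme.
have := theta_root (ltnW jD); rewrite -/q rootE qE !mulf_eq0 => /orP[/orP[]|//].
  have := @theta_dec 0%N j; rewrite j0 (ltnW jD) t0 => /(_ isT).
  by rewrite subr_eq0 => /lt_eqF->.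
have := @theta_dec j D; rewrite jD leqnn tD => /(_ isT).
by rewrite addr_eq0 => /gt_eqF->.
Qed.

Lemma inner_zero l : root (p m) l -> exists2 j, (0 < j < D)%N & l = theta j.
Proof.
move=> pl; have /andP[lk kl] := zero_lt_k pl; have [t0 tD] := theta_extreme.
have [j jD lj] : exists2 j, (j <= D)%N & l = theta j.
  by apply: zero_is_theta; rewrite /q rootM pl orbT.
exists j => //; case: j jD lj => [|j] jD lj; first by move: kl; rewrite lj t0 ltxx.
rewrite /= ltn_neqAle jD andbT; apply/eqP => jD'.
by move: lk; rewrite lj jD' tD ltxx.
Qed.

(** Coming from [k], where all [p i] are positive, the first zero met is a zero
    of [p m] alone, by [p_right_pos]; it is therefore [theta 1]. *)
Lemma p_theta1_neq0 i : (i < m)%N -> (p i).[theta 1%N] != 0.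
Proof.
pose ps := [seq p i | i <- iota 0 m.+1].
have psP r : reflect (exists2 j, (j <= m)%N & r = p j) (r \in ps).
  by apply: (iffP mapP) => -[j jm ->]; exists j => //; move: jm; rewrite mem_iota.
have pos_k : {in ps, forall r, 0 < r.[k]}.
  by move=> _ /psP[j jm ->]; apply: lt_le_trans ltr01 _; rewrite p_ge1 // leqW.
have pm : p m \in ps by apply/psP; exists m.
have m0 : (0 < 1 < D)%N by apply/andP; split => //; rewrite ltnS; apply: ltnW; apply: ltnW.
have t1 := theta_inner m0; have /andP[_ /ltW t1k] := zero_lt_k t1.
have [t [/andP[t1t tk] ge0 [_ /psP[j jm ->] jt]]] := first_zero_from_right pos_k pm t1k t1.
have pos := @p_right_pos t (fun i im => ge0 _ (introT (psP _) (ex_intro2 _ _ i im erefl))).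
have jm' : j = m.
  move: jm; rewrite leq_eqVlt => /predU1P[//|/pos].
  by rewrite (rootP jt) ltxx.
rewrite jm' in jt; have [h /andP[h0 hD] th] := inner_zero jt.
have -> : theta 1%N = t.
  by apply/eqP; rewrite eq_le t1t th theta_le // h0 ltnW.
by move/pos/lt0r_neq0.
Qed.

(** By parity of [p m], negation permutes the [theta j]; it reverses their
    order, which leaves only one possible permutation. *)
Lemma theta_opp j : (j <= D)%N -> theta (D - j) = - theta j.
Proof.
have opp i : (i <= D)%N -> exists2 j, (j <= D)%N & - theta i = theta j.
  move/theta_root/rootP; rewrite -/q => qi; apply: zero_is_theta; apply/rootP.
  move: qi; rewrite !qE p_parity // => e.
  by rewrite mulrCA (_ : (- _ - _) * _ = (theta i - k) * (theta i + k)); [rewrite e mulr0|ring].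
have le i : (i <= D)%N -> theta (D - i) <= - theta i.
  elim: i => [|i IH] iD.
    by rewrite subn0; have [-> ->] := theta_extreme.
  have [h hD eh] := opp _ iD; rewrite eh; apply: theta_le; rewrite leq_subr andbT.
  have := @theta_dec i i.+1; rewrite ltnSn iD -ltrN2 eh => /(_ isT) /(le_lt_trans (IH (ltnW iD))).
  move=> lt; have : (h < D - i)%N.
    rewrite ltnNge; apply/negP => hi; have := @theta_le (D - i) h.
    by rewrite hi hD leNgt lt => /(_ isT).
  lia.
have ge i : (i <= D)%N -> - theta (D - i) <= theta i.
  elim: i => [|i IH] iD.
    by rewrite subn0; have [-> ->] := theta_extreme; rewrite opprK.
  have [h hD eh] := opp _ (leq_subr i.+1 D); rewrite eh; apply: theta_le.
  rewrite hD andbT ltnNge; apply/negP => hi.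
  have := @theta_dec (D - i.+1) (D - i); rewrite leq_subr andbT ltn_sub2l // => /(_ isT).
  have := IH (ltnW iD); have := @theta_le h i; rewrite hi ltnW // -eh => /(_ isT).
  lra.
by move=> jD; apply/eqP; rewrite eq_le le // lerNl ge.
Qed.

(** The same sweep, from [0] to [- theta d], with the even-indexed polynomials
    signed so as to be positive at [0]; going left through negative numbers lets
    [first_zero_from_right] apply, and the even polynomials do not see the sign. *)
Lemma p_theta_mid_neq0 d i : m = d.*2 -> (i < m)%N -> (p i).[theta d] != 0.
Proof.
move=> md.
pose ps := [seq (-1) ^+ j *: p j.*2 | j <- iota 0 d.+1].
have psP r : reflect (exists2 j, (j <= d)%N & r = (-1) ^+ j *: p j.*2) (r \in ps).
  by apply: (iffP mapP) => -[j jm ->]; exists j => //; move: jm; rewrite mem_iota.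
have pos_0 : {in ps, forall r, 0 < r.[0]}.
  by move=> _ /psP[j jm ->]; rewrite hornerZ p_even_at0 // md leq_double.
have evenE j l : (j <= d)%N -> (p j.*2).[- l] = (p j.*2).[l].
  by move=> jd; rewrite p_parity ?leqW ?md ?leq_double // -signr_odd odd_double mul1r.
have td : theta d.+1 = - theta d by rewrite -theta_opp /D; [congr theta|]; lia.
have dD : (d < D)%N by rewrite /D; lia.
have td0 : 0 < theta d by have := @theta_dec d d.+1; rewrite ltnSn dD td => /(_ isT); lra.
have root_d : root ((-1) ^+ d *: p d.*2) (- theta d).
  rewrite rootE hornerZ evenE // -md (rootP (theta_inner _)) ?mulr0 // /D; lia.
have qps : (-1) ^+ d *: p d.*2 \in ps by apply/psP; exists d.
have le0 : - theta d <= 0 by lra.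
have [t [/andP[tdt t0] ge0 [_ /psP[j jd ->] jt]]] :=
  first_zero_from_right pos_0 qps le0 root_d.
have {}jt : (p j.*2).[- t] = 0.
  by move/rootP/eqP: jt; rewrite hornerZ mulf_eq0 signr_eq0 evenE // => /eqP.
have tlt0 : 0 < - t.
  rewrite oppr_gt0 lt_neqAle t0 andbT; apply/eqP => t00.
  have := @p_even_at0 j; rewrite md leq_double => /(_ jd).
  by move: jt; rewrite t00 oppr0 => ->; rewrite mulr0 ltxx.
have neq := @p_left_neq0 d (- t) md tlt0.
have {}neq : forall i, (i < m)%N -> (p i).[- t] != 0.
  apply: neq => h hd; rewrite evenE // -hornerZ.
  by apply: ge0; apply/psP; exists h.
have jd' : j.*2 = m.
  apply/eqP; rewrite eqn_leq {1}md leq_double jd leqNgt; apply/negP => /neq.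
  by rewrite jt eqxx.
rewrite jd' in jt; have [h /andP[h0 hD] th] := inner_zero (introT rootP jt).
suff -> : theta d = - t by move/neq.
apply/eqP; rewrite eq_le {1}th andbC lerNl tdt /=.
have hd : (h <= d)%N.
  rewrite leqNgt; apply/negP => dh; have := @theta_le d.+1 h.
  by rewrite dh ltnW // td -th => /(_ isT); lra.
by rewrite theta_le // hd /D; lia.
Qed.

End Zeros.
End ThreeTermRecurrence.

Local Open Scope complex_scope.

(** * Distance matrices and dual idempotents *)

Section DistanceMatrices.
Variables (R : realType) (X : finType) (G : graph X) (x : X).
Local Notation C := R[i].
Local Notation A i := (distance_mx R G i).
Local Notation E i := (Estar R G x i).
Hypothesis hbip : bipartite G.
Implicit Types (i j h : nat) (y z : X).

Lemma sum_enum_val (F : X -> C) : \sum_(u < #|X|) F (enum_val u) = \sum_y F y.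
Proof. by rewrite -(big_enum_val (A := X) F). Qed.

Lemma Estar_mulE n i (M : 'M[C]_(#|X|, n)) u t :
  (E i *m M) u t = (dist G x (enum_val u) == i)%:R * M u t.
Proof. by rewrite mul_diag_mx !mxE. Qed.

Lemma mul_EstarE n i (M : 'M[C]_(n, #|X|)) u t :
  (M *m E i) u t = M u t * (dist G x (enum_val t) == i)%:R.
Proof. by rewrite mul_mx_diag !mxE. Qed.

Lemma distance_mx0 : A 0 = 1%:M.
Proof.
by apply/matrixP => u t; rewrite !mxE dist_eq0 (inj_eq enum_val_inj).
Qed.

Lemma distance_mx_diam i : (diam G < i)%N -> A i = 0.
Proof.
move=> iD; apply/matrixP => u t; rewrite !mxE.
by have := dist_diam G (enum_val u) (enum_val t); case: eqP => // ->; rewrite leqNgt iD.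
Qed.

Lemma adj_distance_mx (hdr : distance_regular G) (hD : (1 <= diam G)%N) i :
  A 1 *m A i.+1 = (b_ G i)%:R *: A i + (c_ G i.+2)%:R *: A i.+2.
Proof.
apply/matrixP => u t; rewrite !mxE.
under eq_bigr do rewrite !mxE -natrM mulnb.
rewrite (sum_enum_val (fun y => ((dist G (enum_val u) y == 1%N) &&
   (dist G y (enum_val t) == i.+1))%:R)) -natr_sum.
set y := enum_val u; set z := enum_val t.
have -> : (\sum_w ((dist G y w == 1) && (dist G w z == i.+1))%N =
           #|sphere_meet G 1 i.+1 y z|)%N.
  by rewrite -sum1_card [RHS]big_mkcond; apply: eq_bigr => w _; rewrite inE; case: (_ && _).
case: (dist G y z =P i) => [dyz|ni].
  rewrite (ltn_eqF (_ : dist G y z < i.+2)%N) ?dyz ?ltnS ?leqnSn //.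
  by rewrite mulr0 addr0 mulr1 -{1}dyz b_E // dyz.
case: (dist G y z =P i.+2) => [dyz|ni2].
  by rewrite mulr0 add0r mulr1 -[i.+1]/(i.+2.-1) -{1}dyz c_E // dyz.
rewrite !mulr0 addr0 (_ : #|_| = 0%N) //.
apply/eqP; rewrite cards_eq0 -subset0; apply/subsetP => w; rewrite !inE.
case/andP=> /eqP yw /eqP wz; have := dist_adj hbip z yw.
by rewrite !(distC G z) wz => -[[]|] => [/esym/ni|/esym/ni2].
Qed.

(** Neighbours of a vertex of the [i]-th sphere lie on the two adjacent
    spheres, so [A] raises or lowers the index by one. *)
Lemma Estar_adj i :
  E i.+1 *m A 1 = E i.+1 *m A 1 *m E i + E i.+1 *m A 1 *m E i.+2.
Proof.
apply/matrixP => u t; rewrite [RHS]mxE !mul_EstarE -mulrDr Estar_mulE !mxE.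
set y := enum_val u; set z := enum_val t.
case: (dist G x y =P i.+1) => [dy|]; last by rewrite !mul0r.
case: (dist G y z =P 1%N) => [dyz|]; last by rewrite mulr0 mul0r.
have := dist_adj hbip x dyz; rewrite dy => -[->|[->]].
  by rewrite eqxx gtn_eqF ?add0r ?mulr1 // ltnS leqnSn.
by rewrite eqxx ltn_eqF ?addr0 ?mulr1 // ltnS leqnSn.
Qed.

Lemma Estar_idem i : E i *m E i = E i.
Proof.
apply/matrixP => u t; rewrite Estar_mulE !mxE; case: (u == t); rewrite ?mulr0 //.
by rewrite !mulr1n -natrM mulnb andbb.
Qed.

Lemma Estar_orth i j : i != j -> E i *m E j = 0.
Proof.
move=> ij; apply/matrixP => u t; rewrite Estar_mulE !mxE.
case: (u == t); rewrite ?mulr0 // !mulr1n -natrM mulnb.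
by case: eqP => // ->; rewrite (negPf ij).
Qed.

Lemma Estar_distance_Estar0 i j h :
  (j + h < i)%N || (i + h < j)%N -> E i *m A j *m E h = 0.
Proof.
move=> far; apply/matrixP => u t; rewrite mul_EstarE Estar_mulE !mxE.
set y := enum_val u; set z := enum_val t.
case: (dist G x y =P i) => [dy|]; last by rewrite !mul0r.
case: (dist G y z =P j) => [dyz|]; last by rewrite mulr0 mul0r.
case: (dist G x z =P h) => [dz|]; last by rewrite mulr0.
have := dist_triangle G z x y; have := dist_triangle G x y z.
rewrite (distC G z y) (distC G y x) dy dyz dz; lia.
Qed.

(** Only the distances [i], [i + 2] and [i + 4] occur between a vertex of the
    sphere of radius [i + 2] and one of the sphere of radius [2]. *)
Lemma Estar_sum_Estar2 i :
  E i.+2 *m (A i + A i.+2 + A i.+4) *m E 2 = E i.+2 *m const_mx 1 *m E 2.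
Proof.
apply/matrixP => u t; rewrite !mul_EstarE !Estar_mulE !mxE.
set y := enum_val u; set z := enum_val t.
case: (dist G x y =P i.+2) => [dy|]; last by rewrite !mul0r.
case: (dist G x z =P 2%N) => [dz|]; last by rewrite !mulr0.
rewrite !mul1r !mulr1.
have := dist_triangle G z x y; have := dist_triangle G x y z.
have := odd_dist hbip y x z; rewrite (distC G z y) (distC G y x) dy dz.
rewrite /= negbK addbF => o t1 t2.
have [s e s4] : exists2 s, dist G y z = (i + s)%N & (s <= 4)%N.
  by exists (dist G y z - i)%N; lia.
have {}o : odd s = false by move: o; rewrite e oddD; do 2 case: odd.
rewrite e; move: s o s4 {e} => [|[|[|[|[|s]]]]] //= _ _; rewrite ?addn0 ?addn2 ?addn4.
- by rewrite eqxx !ltn_eqF /= ?addr0 // !ltnS ?leqnSn // !leqW.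
- by rewrite eqxx gtn_eqF ?ltn_eqF /= ?addr0 ?add0r.
- by rewrite eqxx !gtn_eqF /= ?add0r // !ltnS !leqW.
Qed.

Lemma inner_mulmx (B : 'M[C]_#|X|) (u w : 'cV[C]_#|X|) :
  B^T = B -> map_mx Num.conj B = B -> inner (B *m u) w = inner u (B *m w).
Proof. by move=> Bt Bc; rewrite /inner trmx_mul Bt map_mxM Bc mulmxA. Qed.

Lemma distance_mx_sym i : (A i)^T = A i.
Proof. by apply/matrixP => u t; rewrite !mxE distC. Qed.

Lemma distance_mx_conj i : map_mx Num.conj (A i) = A i.
Proof. by apply/matrixP => u t; rewrite !mxE conjC_nat. Qed.

Lemma Estar_sym i : (E i)^T = E i.
Proof. exact: tr_diag_mx. Qed.

Lemma Estar_conj i : map_mx Num.conj (E i) = E i.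
Proof.
by apply/matrixP => u t; rewrite !mxE; case: (u == t); rewrite ?mulr1n ?mulr0n ?conjC_nat ?conjC0.
Qed.

Lemma innerZl (a : C) (u w : 'cV[C]_#|X|) : inner (a *: u) w = a * inner u w.
Proof. by rewrite /inner linearZ -scalemxAl mxE. Qed.

Lemma innerZr (r : R) (u w : 'cV[C]_#|X|) : inner u (r%:C *: w) = r%:C * inner u w.
Proof. by rewrite /inner map_mxZ -scalemxAr mxE; congr (_ * _); exact: conjc_real. Qed.

End DistanceMatrices.

(** * The polynomials of the graph *)

Section GraphPolynomials.
Variables (R : realType) (X : finType) (G : graph X) (x : X) (m : nat).
Local Notation C := R[i].
Local Notation A i := (distance_mx R G i).
Local Notation p i := (p_ R G i).
Local Notation f i := (f_ R G i).
Local Notation b i := ((b_ G i)%:R : R).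
Local Notation c i := ((c_ G i)%:R : R).
Local Notation k := ((valency G)%:R : R).
Hypothesis hdr : distance_regular G.
Hypothesis hbip : bipartite G.
Hypothesis hdiam : diam G = m.+1.
Hypothesis m_ge3 : (3 <= m)%N.

Let hD : (1 <= diam G)%N. Proof. by rewrite hdiam. Qed.

Lemma cR_gt0 i : (0 < i <= m.+1)%N -> 0 < c i.
Proof. by move=> iD; rewrite ltr0n (c_gt0 hdr hD x) // hdiam. Qed.

Lemma bR_gt0 i : (i < m.+1)%N -> 0 < b i.
Proof. by move=> iD; rewrite ltr0n (b_gt0 hdr hD x) // hdiam. Qed.

Lemma bR_last : b m.+1 = 0.
Proof. by rewrite -hdiam (b_diam hdr hD x). Qed.

Lemma bcR_sum i : (i <= m.+1)%N -> b i + c i = k.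
Proof. by move=> iD; rewrite -natrD (b_add_c hdr hD x) // hdiam. Qed.

Let c_neq0 i : (0 < i <= m.+1)%N -> c_ G i != 0%N.
Proof. by move/cR_gt0; rewrite ltr0n lt0n. Qed.

Lemma p_0 : p 0%N = 1.
Proof. by rewrite /p_ big_mkcond big_ord1. Qed.

Lemma p_1 : p 1%N = f 1%N.
Proof. by rewrite /p_ big_mkcond big_ord_recr big_ord1 /= add0r. Qed.

Lemma p_S i : p i.+2 = p i + f i.+2.
Proof.
rewrite /p_ !(big_mkcond (fun j : 'I__ => _ == _)) 2!big_ord_recr /= eqxx.
rewrite negbK; case: (odd i) => /=; rewrite addr0; congr (_ + _);
by apply: eq_bigr => j _; rewrite ?negbK.
Qed.

Lemma p_rec1 : 'X * p 0%N = c 1%N *: p 1%N.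
Proof. by rewrite p_0 p_1 -f_1 ?c_neq0. Qed.

(** In the sum of the recurrences of the [f j] of one parity, every [f j] of the
    other parity except the last collects the coefficient [b_j + c_j = k]. *)
Lemma p_rec i : (i.+2 <= m.+1)%N ->
  'X * p i.+1 = c i.+2 *: p i.+2 + b i.+2 *: p i.
Proof.
suff : (i.+2 <= m.+1)%N -> ('X * p i.+1 = c i.+2 *: p i.+2 + b i.+2 *: p i) /\
    ((i.+3 <= m.+1)%N -> 'X * p i.+2 = c i.+3 *: p i.+3 + b i.+3 *: p i.+1).
  by move=> H /H[].
have cE h j : (h <= m.+1)%N -> (j <= m.+1)%N -> c h = b j + c j - b h.
  by move=> hm jm; rewrite bcR_sum // -(bcR_sum hm) addrAC subrr add0r.
elim: i => [|i IH] iD.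
  split=> [|iD'].
    rewrite p_1 f_rec ?c_neq0 // (p_S 0) p_0 (cE 2%N 0%N) // (c_0 hdr hD x) -!mul_polyC.
    by rewrite !polyCB !polyCD polyC0; move: (f 2) => f2; rewrite [f 0]/=; ring.
  rewrite (p_S 1) (p_S 0) mulrDr p_rec1 f_rec ?c_neq0 // p_1 (cE 1%N 3%N) // -!mul_polyC.
  by rewrite !polyCB !polyCD; move: (f 1) (f 2) (f 3) => f1 f2 f3; ring.
have [e1 e2] := IH (ltnW iD); split; first exact: e2.
move=> iD'; rewrite (p_S i.+1) mulrDr e1 ?f_rec ?c_neq0 // (p_S i.+2) (p_S i).
rewrite (cE i.+2 i.+4) ?(ltnW (ltnW iD')) // -!mul_polyC !polyCB !polyCD.
by move: (f i.+2) (f i.+4) (p i) => f2 f4 q; ring.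
Qed.

(** A row eigenvector of [A] is one of every distance matrix, because
    [A i = f i (A)]. *)
Lemma eigenvector_distance_mx (u : 'rV[C]_#|X|) (t : R) i :
  u *m A 1 = t%:C *: u -> (i <= m.+1)%N -> u *m A i = ((f i).[t])%:C *: u.
Proof.
move=> uA; suff H j : (j.+1 <= m.+1)%N ->
    u *m A j = ((f j).[t])%:C *: u /\ u *m A j.+1 = ((f j.+1).[t])%:C *: u.
  case: i => [_|i iD]; last by have [] := H i iD.
  by have [] := H 0%N isT.
elim: j => [|j IH] jD.
  rewrite distance_mx0 mulmx1 /= hornerC scale1r; split => //.
  by rewrite uA hornerZ hornerX (c_1 hdr hD x) invr1 mul1r.
have [e0 e1] := IH (ltnW jD); split => //.
have c2 : c_ G j.+2 != 0%N by rewrite c_neq0.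
have cC : (c_ G j.+2)%:R != 0 :> C by rewrite pnatr_eq0.
have := congr1 (mulmx u) (adj_distance_mx R hbip hdr hD j).
rewrite mulmxA uA -scalemxAl e1 mulmxDr -!scalemxAr e0 => e.
apply: (scalerI cC).
move/(congr1 (fun q : {poly R} => (q.[t])%:C)): (f_rec R c2).
rewrite hornerM hornerX hornerD !hornerZ !(rmorphD, rmorphM) /= !rmorph_nat => fe.
apply: (addrI ((b_ G j)%:R *: (((f j).[t])%:C *: u))).
by rewrite -e !scalerA -scalerDl -fe.
Qed.

(** [(X^2 - k^2) p m = k (X f_D - b_(D-1) f_(D-1))] with [D = m.+1], and the
    second factor on the right vanishes at [t] because [A A_D = b_(D-1) A_(D-1)]. *)
Lemma eigenvalue_root (t : R) : eigenvalue (A 1) t%:C ->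
  root (('X^2 - (k ^+ 2)%:P) * p m) t.
Proof.
case/eigenvalueP=> u uA u0.
have ef : t * (f m.+1).[t] = b m * (f m).[t].
  have := congr1 (mulmx u) (adj_distance_mx R hbip hdr hD m).
  rewrite (@distance_mx_diam _ _ _ m.+2) ?hdiam // scaler0 addr0.
  rewrite mulmxA uA -scalemxAl -scalemxAr !(eigenvector_distance_mx uA) //.
  rewrite !scalerA => /eqP; rewrite -subr_eq0 -scalerBl scaler_eq0 (negPf u0) orbF.
  rewrite -(rmorph_nat (real_complex R)) -!rmorphM subr_eq0 => /eqP.
  exact: (fmorph_inj (real_complex R)).
case: m m_ge3 hdiam ef (@p_rec) bR_last (@bcR_sum) => [|[|j]] // j1 _ ef prec bl bc.
have := congr1 (horner^~ t) (prec j.+1 (leqnn _)).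
have := congr1 (horner^~ t) (prec j (leqnSn _)).
have := bc j.+3 (leqnn _); have := bc j.+2 (leqnSn _).
rewrite bl add0r scale0r addr0 !hornerM hornerX hornerD !hornerZ.
move=> bck ck e1 e2.
rewrite (p_S j.+1) hornerD mulrDr ck in e2.
have fm : (f j.+2).[t] = (p j.+2).[t] - (p j).[t] by rewrite p_S hornerD addrAC subrr add0r.
rewrite rootE !hornerE; apply/eqP.
transitivity (t * (t * (p j.+2).[t]) - k ^+ 2 * (p j.+2).[t]); first by ring.
rewrite e2 mulrDr !(mulrCA t) ef e1 fm -bck; ring.
Qed.

Lemma p_theta_neq0 (theta : nat -> R) n i :
    ordered_eigenvalues G theta ->
    (if odd (diam G) then n = 1%N \/ n = (diam G)./2 else n = 1%N) ->
  (i < m)%N -> (p i).[theta n] != 0.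
Proof.
move=> [dec eig] hn im; rewrite hdiam in dec eig hn.
have root_th j : (j <= m.+1)%N -> root (('X^2 - (k ^+ 2)%:P) * p m) (theta j).
  by move=> jD; apply: eigenvalue_root; apply/eig; exists j.
have n1 : n = 1%N -> (p i).[theta n] != 0.
  move=> ->; exact: (p_theta1_neq0 cR_gt0 bR_gt0 bR_last bcR_sum p_0 p_rec1 p_rec
    m_ge3 dec root_th).
move: hn; case: ifP => [od|_ /n1//] [/n1//|->].
have md : m = (m.+1./2).*2.
  by move: od => /= /negPf ev; rewrite -[LHS]odd_double_half ev uphalf_half ev.
exact: (p_theta_mid_neq0 cR_gt0 bR_gt0 bR_last bcR_sum p_0 p_rec1 p_rec
    m_ge3 dec root_th md).
Qed.

End GraphPolynomials.

(** * Solving the recurrence for the ratios *)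

(** The solution of the recurrence for the scalars [r i] with [u_i = r i w_i],
    where the [P i] are the values of the [p_ i] at the eigenvalue. *)
Definition far_near_ratio (F : fieldType) (b c P : nat -> F) i : F :=
  b i.+2 * b i.+3 * P i / (c i.+1 * c i.+2 * P i.+2).

(** The coefficient with which [w_(i+1)] is lowered to a multiple of [w_i]. *)
Definition lowering_coef (F : fieldType) (b c P : nat -> F) i : F :=
  b i.+2 * c i.+3 * P i * P i.+3 / (c i.+1 * P i.+2 * P i.+1).

Section Ratios.
Variables (F : fieldType) (b c P : nat -> F) (k t : F) (m : nat).
Hypothesis c0 : c 0%N = 0.
Hypothesis c1 : c 1%N = 1.
Hypothesis c_neq0 : forall i, (i <= m)%N -> c i.+1 != 0.
Hypothesis b_neq0 : forall i, (i <= m)%N -> b i != 0.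
Hypothesis bc_sum : forall i, (i <= m)%N -> b i + c i = k.
Hypothesis P0 : P 0%N = 1.
Hypothesis P1 : P 1%N = t.
Hypothesis P_rec : forall i, (i < m)%N -> t * P i.+1 = c i.+2 * P i.+2 + b i.+2 * P i.
Hypothesis P_neq0 : forall i, (i < m)%N -> P i != 0.
Local Notation ratio := (far_near_ratio b c P).
Local Notation lowering := (lowering_coef b c P).

Lemma c2P2 : (0 < m)%N -> t ^+ 2 - b 2 = c 2 * P 2.
Proof. by move=> m0; have := P_rec m0; rewrite P0 P1 expr2 => ->; ring. Qed.

Lemma far_near_ratio0 : (0 < m)%N -> ratio 0 = b 2 * b 3 / (t ^+ 2 - b 2).
Proof. by move=> m0; rewrite /far_near_ratio c2P2 // c1 P0 mulr1 mul1r. Qed.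

(** After replacing [b i + c i] by [b i.+2 + c i.+2], this is the recurrence
    for the [P i], used once to express [P i.+3] and once to express [P i.-1]. *)
Lemma lowering_ratio i : (i.+3 < m)%N ->
  b i - c i.+2 * (1 + ratio i) + c i * (if i is j.+1 then 1 + ratio j else 0) = lowering i.
Proof.
move=> im; have im2 : (i.+2 < m)%N := ltnW im; have im1 := ltnW im2; have im0 := ltnW im1.
have c3 := c_neq0 (ltnW im2); have c2 := c_neq0 (ltnW im1).
have cc1 := c_neq0 (ltnW im0).
have P3 : P i.+3 = (t * P i.+2 - b i.+3 * P i.+1) / c i.+3.
  by rewrite P_rec // addrK mulrAC divff ?mul1r.
have p1 := P_neq0 im1; have p2 := P_neq0 im2.
have bE : b i = b i.+2 + c i.+2 - c i.
  by rewrite bc_sum ?(ltnW im2) // -(bc_sum (ltnW im0)) addrK.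
rewrite bE /lowering_coef P3 /far_near_ratio.
case: i im im2 im1 im0 {bE P3} cc1 c2 c3 p1 p2 => [|j] im im2 im1 im0 cc1 c2 c3 p1 p2.
  rewrite c0 P0 c1 P1 in p1 p2 *.
  by field; rewrite c2 c3 p1 p2.
have b2 := b_neq0 (ltnW im1); have cj := c_neq0 (ltnW (ltnW im0)).
have -> : P j = (t * P j.+1 - c j.+2 * P j.+2) / b j.+2.
  by rewrite P_rec ?(ltnW im0) // addrAC subrr add0r mulrAC divff ?mul1r.
by field; rewrite cj cc1 c2 c3 p1 p2 b2.
Qed.

Lemma lowering_neq0 i : (i.+3 < m)%N -> lowering i != 0.
Proof.
move=> im; have im2 : (i.+2 < m)%N := ltnW im; have im1 := ltnW im2; have im0 := ltnW im1.
rewrite /lowering_coef !mulf_neq0 ?invr_neq0 ?mulf_neq0 ?P_neq0 ?c_neq0 ?b_neq0 //;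
  by rewrite ltnW // ltnW.
Qed.

Lemma ratio_lowering i : (i.+3 < m)%N -> b i.+4 * ratio i = ratio i.+1 * lowering i.
Proof.
move=> im; have im2 : (i.+2 < m)%N := ltnW im; have im1 := ltnW im2; have im0 := ltnW im1.
have c3 := c_neq0 (ltnW im2); have c2 := c_neq0 (ltnW im1).
have cc1 := c_neq0 (ltnW im0).
have p0 := P_neq0 im0; have p1 := P_neq0 im1; have p2 := P_neq0 im2; have p3 := P_neq0 im.
by rewrite /far_near_ratio /lowering_coef; field; rewrite p1 p2 p3 cc1 c2 c3.
Qed.

Section NormFactor.
Variable kappa : nat -> F.
Hypothesis kappa0 : kappa 0%N = 1.
Hypothesis kappa_rec : forall i, (i <= m)%N -> kappa i * b i = kappa i.+1 * c i.+1.

(** [kappa i] stands for the number [k_i] of vertices at distance [i]. *)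
Definition norm_factor i : F :=
  kappa i * b i * b i.+1 * c i.+1 * c i.+2 / (b 0%N * b 1%N * (t ^+ 2 - b 2)) *
  (P i.+2 / P i).

Lemma norm_factor0 : (2 < m)%N -> norm_factor 0 = 1.
Proof.
move=> m2; have m1 := ltnW m2; rewrite /norm_factor kappa0 c2P2 ?(ltnW m1) // c1 P0.
by field; rewrite oner_neq0 (P_neq0 m2) (c_neq0 (ltnW m1)) (b_neq0 (ltnW m1)) b_neq0.
Qed.

Lemma norm_factorS i : (i.+3 < m)%N ->
  c i.+1 * norm_factor i.+1 = lowering i * norm_factor i.
Proof.
move=> im; have im2 : (i.+2 < m)%N := ltnW im; have im1 := ltnW im2; have im0 := ltnW im1.
have cc1 := c_neq0 (ltnW im0).
have p0 := P_neq0 im0; have p1 := P_neq0 im1; have p2 := P_neq0 im2.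
have kE : kappa i.+1 = kappa i * b i / c i.+1 by rewrite kappa_rec ?mulfK // ltnW.
have m2 : (2 < m)%N by apply: leq_trans im2.
rewrite /norm_factor /lowering_coef c2P2 ?(leq_trans _ m2) // kE; field.
by rewrite cc1 p0 p1 p2 P_neq0 // c_neq0 ?b_neq0 // (leq_trans _ m2).
Qed.

End NormFactor.
End Ratios.

(** * Thin modules of endpoint two *)

(** [r] and [l] stand for any solution of the recurrence that starts from the
    local eigenvalue [-1 - r 0]: such a solution turns out to be the ratio
    between [u i] and [w i] and the coefficient with which [w i.+1] is lowered to
    [w i]. *)
Section ThinModule.
Variables (R : realType) (X : finType) (G : graph X) (x : X) (m : nat).
Variables (W : {vspace 'cV[R[i]]_#|X|}) (v : 'cV[R[i]]_#|X|).
Variables r l : nat -> R.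
Local Notation C := R[i].
Local Notation A i := (distance_mx R G i).
Local Notation E i := (Estar R G x i).
Local Notation b i := ((b_ G i)%:R : R).
Local Notation c i := ((c_ G i)%:R : R).
Hypothesis hdr : distance_regular G.
Hypothesis hbip : bipartite G.
Hypothesis hdiam : diam G = m.+1.
Hypothesis m_ge3 : (3 <= m)%N.
Hypothesis hW : T_module G x W.
Hypothesis hthin : thin G x W.
Hypothesis hend : has_endpoint G x W 2.
Hypothesis hloc : has_local_eigenvalue G x W (-1 - r 0%N)%:C.
Hypothesis hv : v \in EstarV G x 2 W.
Hypothesis hv0 : v != 0.
Hypothesis l_eq : forall i, (i.+3 < m)%N ->
  b i - c i.+2 * (1 + r i) + c i * (if i is j.+1 then 1 + r j else 0) = l i.
Hypothesis l_neq0 : forall i, (i.+3 < m)%N -> l i != 0.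
Hypothesis r_rec : forall i, (i.+3 < m)%N -> b i.+4 * r i = r i.+1 * l i.

Let hD : (1 <= diam G)%N. Proof. by rewrite hdiam. Qed.
Let c_pos := @cR_gt0 R X G x m hdr hdiam.

Let A_W w : w \in W -> A 1 *m w \in W.
Proof. by apply: hW; exact: T_adj. Qed.

Let E_W i w : (i <= m.+1)%N -> w \in W -> E i *m w \in W.
Proof. by move=> iD; apply: hW; apply: T_Estar; rewrite hdiam. Qed.

Let distance_W i w : (i <= m.+1)%N -> w \in W -> A i *m w \in W.
Proof.
move=> iD wW.
suff H j : (j.+1 <= m.+1)%N -> A j *m w \in W /\ A j.+1 *m w \in W.
  by case: i iD => [_|i iD]; [have [] := H 0%N isT|have [] := H i iD].
elim: j => [|j IH] jD; first by rewrite distance_mx0 mul1mx wW A_W.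
have [W0 W1] := IH (ltnW jD); split=> //.
have cC : (c_ G j.+2)%:R != 0 :> C by rewrite pnatr_eq0 -lt0n -(ltr0n R) c_pos.
have /(congr1 (mulmx^~ w)) := adj_distance_mx R hbip hdr hD j.
rewrite mulmxDl -!scalemxAl -mulmxA => e.
rewrite -[_ *m w](scalerK cC) memvZ // -(addKr ((b_ G j)%:R *: (A j *m w)) (_ *: _)).
by rewrite -e rpredD ?rpredN ?memvZ // A_W.
Qed.

Let E_EstarV i w : w \in W -> E i *m w \in EstarV G x i W.
Proof.
move=> wW; apply/memv_imgP; exists w => //.
by rewrite lfunE.
Qed.

Let E_low i w : (i < 2)%N -> w \in W -> E i *m w = 0.
Proof.
move=> i2 wW; apply/eqP/negP => /negP Ew; have [_ min] := hend.
have : EstarV G x i W != 0%VS.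
  by apply: contraNneq Ew => e0; have := E_EstarV i wW; rewrite e0 memv0.
have iD : (i <= diam G)%N by rewrite hdiam; lia.
by move/(min _ iD); rewrite leqNgt i2.
Qed.

Let E2v : E 2 *m v = v.
Proof.
by have /memv_imgP[w _ ->] := hv; rewrite lfunE /= mulmxA Estar_idem.
Qed.

Let vW : v \in W.
Proof. by have /memv_imgP[w wW ->] := hv; rewrite lfunE /= E_W // ltnS; lia. Qed.

(* What the near, middle and far distance matrices send from [v] to the sphere
   of radius [i + 2]. *)
Let w i := E i.+2 *m A i *m v.
Let z i := E i.+2 *m A i.+2 *m v.
Let u i := E i.+2 *m A i.+4 *m v.

Let far i j : (j + 2 < i)%N || (i + 2 < j)%N -> E i *m A j *m v = 0.
Proof.
by move=> ij; rewrite -E2v mulmxA Estar_distance_Estar0 // mul0mx.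
Qed.

(** The sum of the three vectors is [E_(i+2) J v], and [J v = 0] because the
    entry of [E_0 A_2 v] at [x] is the sum of the entries of [v]. *)
Let zE i : z i = - (w i + u i).
Proof.
have sum0 : (const_mx 1 : 'M[C]_#|X|) *m v = 0.
  have := E_low (isT : (0 < 2)%N) (distance_W (_ : (2 <= m.+1)%N) vW).
  move=> /(_ (ltnW (ltnW m_ge3))) /matrixP /(_ (enum_rank x) 0).
  rewrite Estar_mulE enum_rankK distxx mul1r !mxE => e.
  apply/matrixP => y j; rewrite ord1 !mxE -[RHS]e; apply: eq_bigr => a _.
  rewrite !mxE enum_rankK -E2v Estar_mulE.
  by case: (_ == 2%N); rewrite ?mul1r // !mul0r.
have /(congr1 (mulmx^~ v)) := Estar_sum_Estar2 R x hbip i.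
rewrite -!mulmxA E2v sum0 mulmx0 !mulmxDl !mulmxDr !mulmxA -/(w i) -/(z i) -/(u i).
by move=> e; apply/eqP; rewrite -addr_eq0 addrCA addrA; apply/eqP.
Qed.

Let split_adj i (y : 'cV[C]_#|X|) : E i.+1 *m (A 1 *m y) =
  E i.+1 *m (A 1 *m (E i *m y)) + E i.+1 *m (A 1 *m (E i.+2 *m y)).
Proof. by rewrite !mulmxA {1}Estar_adj // mulmxDl. Qed.

Let adj_far i j : E i *m (A 1 *m (A j.+1 *m v)) =
  (b_ G j)%:R *: (E i *m A j *m v) + (c_ G j.+2)%:R *: (E i *m A j.+2 *m v).
Proof.
rewrite (mulmxA (A 1)) adj_distance_mx // mulmxDl -!scalemxAl mulmxDr -!scalemxAr.
by rewrite !mulmxA.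
Qed.

(** The sphere of radius [i + 4] is too far from the support of [v] for the
    distance [i], so [A A_i v] reaches radius [i + 3] only from below. *)
Lemma raise_near i : E i.+3 *m (A 1 *m w i) = (c_ G i.+1)%:R *: w i.+1.
Proof.
have : E i.+3 *m (A 1 *m (A i *m v)) = (c_ G i.+1)%:R *: w i.+1.
  case: i => [|i]; first by rewrite distance_mx0 mul1mx (c_1 hdr hD x) scale1r mulmxA.
  by rewrite adj_far (@far _ i) ?scaler0 ?add0r //; lia.
rewrite split_adj [E i.+4 *m _]mulmxA (@far _ i) ?mulmx0 ?addr0; last by lia.
by rewrite /w !mulmxA.
Qed.

(** Likewise the sphere of radius [i + 1] is too close for the distance [i + 5]. *)
Lemma lower_far i : E i.+2 *m (A 1 *m u i.+1) = (b_ G i.+4)%:R *: u i.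
Proof.
have := adj_far i.+2 i.+4; rewrite (@far _ i.+4.+2) ?scaler0 ?addr0; last by lia.
rewrite split_adj [E i.+1 *m _]mulmxA (@far i.+1) ?mulmx0 ?add0r; last by lia.
by rewrite /u !mulmxA.
Qed.

(** [E_(i+2) A A_(i+1) v] also receives a contribution raised from the sphere of
    radius [i + 1]: that of [z (i - 1)], or of [E_1 A v = 0] when [i = 0]. *)
Lemma lower_near i : E i.+2 *m (A 1 *m w i.+1) =
  (b_ G i)%:R *: w i + (c_ G i.+2)%:R *: z i -
  (if i is j.+1 then E i.+2 *m (A 1 *m z j) else 0).
Proof.
rewrite -(adj_far i.+2 i) (split_adj i.+1 (A i.+1 *m v)).
set y := E i.+2 *m (A 1 *m (E i.+1 *m (A i.+1 *m v))).
have -> : y = (if i is j.+1 then E i.+2 *m (A 1 *m z j) else 0).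
  rewrite {}/y; case: i => [|i]; last by rewrite /z !mulmxA.
  by rewrite (@E_low 1 (A 1 *m v)) ?mulmx0 // distance_W.
by rewrite addrAC subrr add0r /w !mulmxA.
Qed.

Lemma lower_near_of_ratio i : (i.+3 < m)%N -> u i = (r i)%:C *: w i ->
    (if i is j.+1 then u j = (r j)%:C *: w j else True) ->
  E i.+2 *m (A 1 *m w i.+1) = (l i)%:C *: w i.
Proof.
move=> im ui uj; rewrite lower_near zE ui -(l_eq im).
have -> : (if i is j.+1 then E i.+2 *m (A 1 *m z j) else 0) =
    - (((c_ G i)%:R * (if i is j.+1 then 1 + r j else 0))%:C *: w i).
  case: i {im ui} uj => [|j] uj; first by rewrite mulr0 scale0r oppr0.
  rewrite zE uj -[X in X + _]scale1r -scalerDl !mulmxN -!scalemxAr raise_near scalerA.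
  rewrite mulrC; congr (- (_ *: _)); move: (r j) => a.
  by rewrite rmorphM rmorphD rmorph1 rmorph_nat.
have -> : w i + (r i)%:C *: w i = (1 + (r i)%:C) *: w i.
  by rewrite scalerDl scale1r.
rewrite opprK scalerN scalerA -scalerBl -scalerDl.
congr (_ *: _); move: (r i) (match i with 0%N => _ | _ => _ end) => a s.
by rewrite rmorphD rmorphB !rmorphM rmorphD rmorph1 !rmorph_nat.
Qed.

(** Thinness makes each [E_(i+2) W] a line, so [u i] is a multiple of [w i] as
    soon as [w i] is nonzero; lowering [u i.+1] in two ways gives the factor. *)
Lemma far_eq_ratio_near i : (i.+2 < m)%N -> w i != 0 /\ u i = (r i)%:C *: w i.
Proof.
suff H : (i.+2 < m)%N -> (w i != 0 /\ u i = (r i)%:C *: w i) /\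
    (if i is j.+1 then u j = (r j)%:C *: w j else True).
  by move=> /H[].
elim: i => [|i IH] im.
  split=> //; have w0 : w 0%N = v by rewrite /w distance_mx0 mulmx1.
  rewrite w0; split=> //.
  have := hloc hv; rewrite -!mulmxA E2v mulmxA -/(z 0%N) zE w0 => /eqP.
  rewrite eqr_oppLR => /eqP; rewrite -scaleNr => e.
  rewrite -(addKr v (u 0%N)) e -(scaleN1r v) -scalerDl.
  congr (_ *: _); rewrite -(rmorph1 (real_complex R)) -!rmorphN -rmorphD; congr (_%:C).
  by ring.
have [[wi ui] uj] := IH (ltnW im); split; last exact: ui.
have low := lower_near_of_ratio im ui uj.
have l0 := l_neq0 im.
have w1 : w i.+1 != 0.
  apply: contraNneq wi => w10; move: low; rewrite w10 !mulmx0 => /esym/eqP.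
  by rewrite scaler_eq0 fmorph_eq0 (negPf l0).
split; first exact: w1.
have wE : w i.+1 \in EstarV G x i.+3 W.
  by rewrite /w -mulmxA E_EstarV // distance_W //; lia.
have uE : u i.+1 \in EstarV G x i.+3 W.
  by rewrite /u -mulmxA E_EstarV // distance_W //; lia.
have line : EstarV G x i.+3 W = <[w i.+1]>%VS.
  apply/esym/eqP; rewrite eqEdim dim_vline w1 hthin ?hdiam; last by lia.
  by rewrite -memvE wE.
move: uE; rewrite line => /vlineP[a ua]; rewrite ua; congr (_ *: _).
have := lower_far i; rewrite ua -!scalemxAr low ui !scalerA => /eqP.
rewrite -subr_eq0 -scalerBl scaler_eq0 (negPf wi) orbF subr_eq0 => /eqP e.
apply: (mulIf (_ : (l i)%:C != 0)); first by rewrite fmorph_eq0.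
by rewrite e -(rmorph_nat (real_complex R)) -!rmorphM r_rec.
Qed.

Lemma lower_near_eq i : (i.+3 < m)%N ->
  E i.+2 *m (A 1 *m w i.+1) = (l i)%:C *: w i.
Proof.
move=> im; apply: lower_near_of_ratio => //; first by have [] := far_eq_ratio_near (ltnW im).
by case: i im => // j jm; have [] := @far_eq_ratio_near j ltac:(lia).
Qed.

Let Ew i : E i.+2 *m w i = w i.
Proof. by rewrite /w !mulmxA Estar_idem. Qed.

(** [A] is self-adjoint, so raising [w i] and lowering [w i.+1] have the same
    inner product. *)
Lemma normsq_near_rec i : (i.+3 < m)%N ->
  (c i.+1)%:C * normsq (w i.+1) = (l i)%:C * normsq (w i).
Proof.
move=> im; rewrite rmorph_nat -[LHS]innerZl -raise_near inner_mulmx; last first.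
- exact: Estar_conj.
- exact: Estar_sym.
rewrite Ew inner_mulmx; last first.
- exact: distance_mx_conj.
- exact: distance_mx_sym.
rewrite -{1}Ew inner_mulmx; last first.
- exact: Estar_conj.
- exact: Estar_sym.
by rewrite lower_near_eq // innerZr.
Qed.

End ThinModule.

(** * The norm formula *)

Theorem theorem13p5 (R : realType) (X : finType) (G : graph X) (D : nat)
    (theta : nat -> R) (x : X) (n : nat) (W : {vspace 'cV[R[i]]_#|X|})
    (v : 'cV[R[i]]_#|X|)
    (hbip : bipartite G) (hdr : distance_regular G)
    (hdiam : diam G = D) (hD : (4 <= D)%N) (hk : (3 <= valency G)%N)
    (htheta : ordered_eigenvalues G theta)
    (hn : if odd D then n = 1%N \/ n = D./2 else n = 1%N)
    (hirr : irreducible_T_module G x W) (hthin : thin G x W)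
    (hend : has_endpoint G x W 2)
    (hloc : has_local_eigenvalue G x W
      (-1 - (b_ G 2)%:R * (b_ G 3)%:R / (theta n ^+ 2 - (b_ G 2)%:R))%:C)
    (hv : v \in EstarV G x 2 W) (hv0 : v != 0) :
  let w i := Estar R G x (i + 2) *m distance_mx R G i *m v in
  (forall i j, (i <= D - 4)%N -> (j <= D - 4)%N -> i != j ->
     inner (w i) (w j) = 0) /\
  (forall i, (i <= D - 4)%N ->
     [/\ (valency G)%:R * (b_ G 1)%:R * (theta n ^+ 2 - (b_ G 2)%:R) != 0,
         (p_ R G i).[theta n] != 0 &
         normsq (w i) =
           ((k_ G i)%:R * (b_ G i)%:R * (b_ G i.+1)%:R
              * (c_ G i.+1)%:R * (c_ G i.+2)%:R
            / ((valency G)%:R * (b_ G 1)%:R * (theta n ^+ 2 - (b_ G 2)%:R))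
            * ((p_ R G i.+2).[theta n] / (p_ R G i).[theta n]))%:C
           * normsq v]).
Proof.
case: D hdiam hD hn => // m hdiam; rewrite ltnS => m_ge3 hn w.
have P_neq0 i : (i < m)%N -> (p_ R G i).[theta n] != 0.
  by move=> im; apply: (p_theta_neq0 x hdr hbip hdiam m_ge3 htheta) => //; rewrite hdiam.
have [hW _ _] := hirr.
split=> [i j _ _ ij|i im].
  rewrite /w -mulmxA inner_mulmx; [|exact: Estar_sym|exact: Estar_conj].
  rewrite !mulmxA Estar_orth ?eqn_add2r // !mul0mx.
  by rewrite /inner map_mx0 mulmx0 mxE.
have hD1 : (1 <= diam G)%N by rewrite hdiam.
pose b i : R := (b_ G i)%:R; pose c i : R := (c_ G i)%:R.
pose P i : R := (p_ R G i).[theta n]; pose kappa i : R := (k_ G i)%:R.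
have c0 : c 0%N = 0 by rewrite /c (c_0 hdr hD1 x).
have c1 : c 1%N = 1 by rewrite /c (c_1 hdr hD1 x).
have c_neq0 j : (j <= m)%N -> c j.+1 != 0.
  by move=> jm; rewrite gt_eqF // (cR_gt0 R x hdr hdiam).
have b_neq0 j : (j <= m)%N -> b j != 0.
  by move=> jm; rewrite gt_eqF // (bR_gt0 R x hdr hdiam).
have bc_sum j : (j <= m)%N -> b j + c j = (valency G)%:R.
  by move=> jm; rewrite (bcR_sum R x hdr hbip hdiam) // leqW.
have P0 : P 0%N = 1 by rewrite /P p_0 hornerC.
have P1 : P 1%N = theta n.
  by rewrite /P p_1 /= hornerZ hornerX -/(c 1%N) c1 invr1 mul1r.
have P_rec j : (j < m)%N -> theta n * P j.+1 = c j.+2 * P j.+2 + b j.+2 * P j.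
  move=> jm; have /(congr1 (horner^~ (theta n))) := p_rec R x hdr hbip hdiam jm.
  by rewrite hornerM hornerX hornerD !hornerZ.
have kappa0 : kappa 0%N = 1 by rewrite /kappa (k_0 hdr x).
have kappa_rec j : (j <= m)%N -> kappa j * b j = kappa j.+1 * c j.+1.
  by move=> jm; rewrite /kappa /b /c -!natrM (k_rec hdr hD1 x) // hdiam.
have m0 : (0 < m)%N := leq_trans (isT : 0 < 3)%N m_ge3.
have im2 : (i.+2 < m)%N by lia.
have PE : theta n ^+ 2 - b 2 = c 2 * P 2 := c2P2 P0 P1 P_rec m0.
split.
- rewrite -/(b 2) -/(b 1%N) PE !mulf_neq0 ?b_neq0 ?c_neq0 ?P_neq0 //.
- exact/P_neq0/ltnW/ltnW.
rewrite -[X in _ = X%:C * _]/(norm_factor b c P (theta n) kappa i).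
have hloc' : has_local_eigenvalue G x W (-1 - far_near_ratio b c P 0)%:C.
  by rewrite (far_near_ratio0 c1 P0 P1 P_rec).
have l_eq := lowering_ratio c0 c1 c_neq0 b_neq0 bc_sum P0 P1 P_rec P_neq0.
have l_neq0 := lowering_neq0 c_neq0 b_neq0 P_neq0.
have r_rec := ratio_lowering b c_neq0 P_neq0.
have rec := @normsq_near_rec R X G x m W v (far_near_ratio b c P) (lowering_coef b c P)
  hdr hbip hdiam m_ge3 hW hthin hend hloc' hv hv0 l_eq l_neq0 r_rec.
rewrite /w addn2; elim: i im2 {im} => [|i IH] im.
  rewrite (norm_factor0 c1 c_neq0 b_neq0 P0 P1 P_rec P_neq0 kappa0) // mul1r.
  by have /memv_imgP[y _ ->] := hv; rewrite lfunE /= distance_mx0 mulmx1 mulmxA Estar_idem.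
apply: (mulfI (_ : (c i.+1)%:C != 0)).
  by rewrite fmorph_eq0 c_neq0 //; do 4! apply: ltnW.
rewrite rec // IH ?(ltnW im) // !mulrA -!rmorphM.
by rewrite (norm_factorS c_neq0 b_neq0 P0 P1 P_rec P_neq0 kappa_rec).
Qed.
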